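(* For $N\ge1$ let $p_{N,S,W,\mathcal{R}}(x)=\sum_{n=1}^N s_n w_n(x)$, $x\in\Omega$, be the path approximation by truncated sums. Then $p_{N,S,W,\mathcal{R}}$ always lies in $\mathcal{H}(C)$, and for every $x\in\Omega$ the error $p_{S,W,\mathcal{R}}(x)-p_{N,S,W,\mathcal{R}}(x)$ is a random variable with variance $$C(x,x)-\sum_{n=1}^N w_n(x)^2=\sum_{n=N+1}^\infty w_n(x)^2 .$$ Going from $N$ to $N+1$ decreases this variance by $w_{N+1}(x)^2$ for all $x\in\Omega$.
   Context: $\Omega\subset\mathbb{R}^d$ is a bounded domain and $C:\Omega\times\Omega\to\mathbb{R}$ is a continuous, symmetric, positive definite kernel with reproducing kernel Hilbert space $\mathcal{H}(C)$ of functions on $\Omega$ (the native space of $C$). $W=\{w_n\}_{n\in\mathbb{N}}$ is a complete orthonormal system of $\mathcal{H}(C)$. $\mathcal{R}$ is a probability distribution on $\mathbb{R}$ with mean zero and variance one, and $S=\{s_n\}_{n\in\mathbb{N}}$ is a sequence of independent $\mathcal{R}$-distributed random variables. The $(S,W,\mathcal{R})$-expansion path is the random function $p_{S,W,\mathcal{R}}=\sum_{n\in\mathbb{N}}s_nw_n$, the series converging almost surely at each fixed $x$. *)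

(* Defs.v *)
From HB Require Import structures.
From mathcomp Require Export all_boot all_order all_algebra.
From mathcomp Require Export finmap.
From mathcomp Require Export all_classical all_reals all_analysis.
Export Order.TTheory GRing.Theory Num.Theory.
Export numFieldNormedType.Exports.

Set Implicit Arguments.
Unset Strict Implicit.
Unset Printing Implicit Defensive.

Local Open Scope classical_set_scope.
Local Open Scope ring_scope.

Definition bounded_domain (R : realType) (d : nat) (Omega : set 'rV[R]_d) :=
  [/\ Omega !=set0, open Omega, connected Omega & bounded_set Omega].

Section native_space.
Context {R : realType} {D : Type}.

Definition symmetric_kernel (C : D -> D -> R) := forall x y, C x y = C y x.

(* Aronszajn's convention: the kernel matrices are positive semidefinite.
   Kernels whose matrices at distinct points are positive definite in the
   strict sense are a special case. *)
Definition positive_definite_kernel (C : D -> D -> R) :=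
  forall (n : nat) (x : 'I_n -> D) (c : 'I_n -> R),
    0 <= \sum_(i < n) \sum_(j < n) c i * c j * C (x i) (x j).

(* A real inner-product space of functions on [D] is a set [H] of functions
   together with a form [ip] whose values matter only on [H]. *)
Record inner_product_space (H : set (D -> R))
    (ip : (D -> R) -> (D -> R) -> R) : Prop := {
  ips_zero : H (cst 0) ;
  ips_lin : forall (a : R) f g, H f -> H g -> H (a \*o f \+ g) ;
  ips_sym : forall f g, H f -> H g -> ip f g = ip g f ;
  ips_linl : forall (a : R) f g h, H f -> H g -> H h ->
    ip (a \*o f \+ g) h = a * ip f h + ip g h ;
  ips_ge0 : forall f, H f -> 0 <= ip f f ;
  ips_eq0 : forall f, H f -> ip f f = 0 -> f = cst 0 }.

Definition ip_norm (ip : (D -> R) -> (D -> R) -> R) (f : D -> R) : R :=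
  Num.sqrt (ip f f).

Definition ip_complete (H : set (D -> R)) (ip : (D -> R) -> (D -> R) -> R) :=
  forall u : nat -> D -> R, (forall n, H (u n)) ->
    (forall e : R, 0 < e -> exists M, forall m n,
       (M <= m)%N -> (M <= n)%N -> ip_norm ip (u m \- u n) < e) ->
    exists2 f, H f & ip_norm ip (u n \- f) @[n --> \oo] --> 0.

(* The reproducing kernel Hilbert space of [C]; these properties determine
   [H], and [ip] on [H], uniquely. *)
Record is_native_space (C : D -> D -> R) (H : set (D -> R))
    (ip : (D -> R) -> (D -> R) -> R) : Prop := {
  native_ips : inner_product_space H ip ;
  native_complete : ip_complete H ip ;
  native_kernel : forall x, H (C x) ;
  native_reproducing : forall f x, H f -> ip f (C x) = f x }.

(* Completeness of the system: its linear span is dense in [H]. *)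
Record complete_orthonormal_system (H : set (D -> R))
    (ip : (D -> R) -> (D -> R) -> R) (w : nat -> D -> R) : Prop := {
  cons_mem : forall n, H (w n) ;
  cons_orthonormal : forall m n, ip (w m) (w n) = (m == n)%:R ;
  cons_dense : forall f, H f -> forall e : R, 0 < e ->
    exists (n : nat) (c : nat -> R),
      ip_norm ip (f \- (fun x => \sum_(i < n) c i * w i x)) < e }.

End native_space.

Section paths.
Local Open Scope ereal_scope.
Context {R : realType} {disp : measure_display} {T : measurableType disp}
  {P : probability T R}.

Definition independent_RVs (s : nat -> {RV P >-> R}) :=
  forall (J : {fset nat}) (B : nat -> set R),
    (forall j, measurable (B j)) ->
    P (\bigcap_(j in [set` J]) (s j @^-1` B j)) =
    \prod_(j <- J) P (s j @^-1` B j).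

Definition identically_distributed (Rd : probability R R)
    (s : nat -> {RV P >-> R}) :=
  forall (n : nat) (B : set R), measurable B -> distribution P (s n) B = Rd B.

Context {D : Type}.

(* [s n] and [w n] stand for $s_{n+1}$ and $w_{n+1}$, so the sum below runs
   over the first [N] terms of the expansion. *)
Definition truncated_path (s : nat -> {RV P >-> R}) (w : nat -> D -> R)
    (N : nat) (t : T) (x : D) : R := (\sum_(n < N) s n t * w n x)%R.

(* The almost sure sum is a random variable up to a null set depending on
   [x]; [p] is any choice of it. *)
Definition is_expansion_path (s : nat -> {RV P >-> R}) (w : nat -> D -> R)
    (p : D -> {RV P >-> R}) :=
  forall x, {ae P, forall t, truncated_path s w N t x @[N --> \oo] --> p x t}.

Definition path_error (s : nat -> {RV P >-> R}) (w : nat -> D -> R)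
    (p : D -> {RV P >-> R}) (N : nat) (x : D) (t : T) : R :=
  (p x t - truncated_path s w N t x)%R.

End paths.

(* Main.v *)
Require Import Defs.
From mathcomp Require Import ring lra measurable_realfun.
Local Open Scope classical_set_scope.
Local Open Scope ring_scope.

(** Fix [x] and put [c n = w n x].

    The deterministic half is Parseval's identity in the native space. By the
    reproducing property the coefficients of [C x] in the orthonormal system are
    [ip (C x) (w n) = w n x], and [ip (C x) (C x) = C x x]; completeness of the
    system gives [C x x = \sum_n c n ^+ 2] ([parseval]). The claimed variance
    after [N] terms is thus the tail of this series.

    The probabilistic half says that the error of the path has that tail as its
    variance. Independence makes the [s n] uncorrelated ([covariance_iid]), so
    a finite section [\sum_(N <= i < M) s i * c i] of the path has variance
    [\sum_(N <= i < M) c i ^+ 2] ([variance_block]). The path is only known as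
    an almost sure limit, and the variance passes to the limit in two steps.
    Fatou's lemma bounds the second moment, hence the variance, of the error by
    the tail ([variance_error_le]); in particular the error is square integrable
    and tends to zero in quadratic mean. Conversely, a finite section is the
    difference of two errors, the second of which is negligible for large [M];
    with the Cauchy-Schwarz inequality for covariances this bounds the tail by
    the variance ([variance_error]). *)

(** * Parseval's identity *)

Section parseval.
Context {R : realType} {D : Type} {H : set (D -> R)}
  {ip : (D -> R) -> (D -> R) -> R} {w : nat -> D -> R}.
Hypothesis Hip : inner_product_space H ip.

Definition lincomb (c : nat -> R) (n : nat) : D -> R :=
  fun x => \sum_(i < n) c i * w i x.

Lemma lincombS c n : lincomb c n.+1 = c n \*o w n \+ lincomb c n.
Proof. by apply/funext => x; rewrite /lincomb big_ord_recr/= addrC. Qed.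

Lemma sub_lincombS f c n :
  f \- lincomb c n.+1 = - c n \*o w n \+ (f \- lincomb c n).
Proof. by apply/funext => x /=; rewrite lincombS/=; ring. Qed.

Lemma sub_lincomb0 f c : f \- lincomb c 0 = f.
Proof. by apply/funext => x /=; rewrite /lincomb big_ord0 subr0. Qed.

Lemma lincomb_mem c n : (forall i, H (w i)) -> H (lincomb c n).
Proof.
move=> Hw; elim: n => [|n IHn].
  rewrite (_ : lincomb c 0 = cst 0); first exact: ips_zero Hip.
  by apply/funext => x; rewrite /lincomb big_ord0.
by rewrite lincombS; apply: (ips_lin Hip).
Qed.

Hypothesis Hw : complete_orthonormal_system H ip w.

Lemma sub_lincomb_mem f c n : H f -> H (f \- lincomb c n).
Proof.
move=> Hf; elim: n => [|n IHn]; first by rewrite sub_lincomb0.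
rewrite sub_lincombS; apply: (ips_lin Hip) => //; exact: cons_mem Hw _.
Qed.

(** By orthogonality; this lets the squared norm below be computed one term at a
    time, because the next coefficient is still that of [f]. *)
Lemma ip_sub_lincomb f c n m : H f -> (n <= m)%N ->
  ip (f \- lincomb c n) (w m) = ip f (w m).
Proof.
move=> Hf; elim: n => [|n IHn] nm; first by rewrite sub_lincomb0.
have Hm := cons_mem Hw; rewrite sub_lincombS (ips_linl Hip) ?IHn ?(ltnW nm)//.
  by rewrite (cons_orthonormal Hw) (ltn_eqF nm) mulr0 add0r.
exact: sub_lincomb_mem.
Qed.

(** Completing the square in each coefficient. With [c i = ip f (w i)] the last
    sum vanishes, which is Bessel's inequality; for other [c] the distance to [f]
    only grows, so density of the span forces equality in the limit. *)
Lemma sqnorm_sub_lincomb f c n : H f ->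
  ip (f \- lincomb c n) (f \- lincomb c n) =
  ip f f - \sum_(i < n) ip f (w i) ^+ 2 + \sum_(i < n) (c i - ip f (w i)) ^+ 2.
Proof.
move=> Hf; elim: n => [|n IHn].
  by rewrite sub_lincomb0 !big_ord0 subr0 addr0.
have Hm := cons_mem Hw.
have Hr k : H (f \- lincomb c k) by exact: sub_lincomb_mem.
have lin g : H g -> ip (f \- lincomb c n.+1) g =
    - c n * ip (w n) g + ip (f \- lincomb c n) g.
  by move=> Hg; rewrite sub_lincombS (ips_linl Hip).
rewrite lin// [ip (w n) _](ips_sym Hip)// lin//.
rewrite [ip (f \- lincomb c n) (f \- lincomb c n.+1)](ips_sym Hip)// lin//.
rewrite [ip (w n) (f \- _)](ips_sym Hip)// ip_sub_lincomb//.
rewrite (cons_orthonormal Hw) eqxx IHn !big_ord_recr/=; ring.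
Qed.

(** The defects of Bessel's inequality are nonnegative and decreasing in [n], and
    any approximation of [f] in the span bounds one of them. *)
Lemma parseval f : H f ->
  \sum_(i < n) ip f (w i) ^+ 2 @[n --> \oo] --> ip f f.
Proof.
move=> Hf; pose b i := ip f (w i).
have res_ge0 n : 0 <= ip f f - \sum_(i < n) b i ^+ 2.
  have := ips_ge0 Hip (sub_lincomb_mem f b n Hf).
  rewrite sqnorm_sub_lincomb// [X in _ + X]big1 ?addr0// => i _.
  by rewrite subrr expr0n.
apply/cvgrPdist_lt => e e0.
(* Density controls norms, and [sqnorm_sub_lincomb] squared norms. *)
have [n [c]] := cons_dense Hw Hf (e := Num.sqrt e) ltac:(by rewrite sqrtr_gt0).
rewrite -[X in f \- X]/(lincomb c n) /ip_norm ltr_sqrt// sqnorm_sub_lincomb//.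
move=> resn; exists n => // m /= nm; rewrite ger0_norm ?res_ge0//.
apply: le_lt_trans resn; rewrite -addrA lerD2l.
(* It remains to compare the defects at [n] and at the later index [m]. *)
rewrite -(big_mkord xpredT (fun i => b i ^+ 2)) (big_cat_nat (n := n))//=.
rewrite big_mkord opprD lerD2l.
apply: (@le_trans _ _ 0).
  by rewrite oppr_le0 sumr_ge0// => i _; exact: sqr_ge0.
by apply: sumr_ge0 => i _; exact: sqr_ge0.
Qed.

End parseval.
Arguments lincomb {R D} w c n.

(** * Square integrable functions *)

Section square_integrable.
Context {d : measure_display} {T : measurableType d} {R : realType}.

Lemma sqr_integrable_Lfun2 (mu : {measure set T -> \bar R}) (X : T -> R) :
  measurable_fun [set: T] X -> (\int[mu]_t (X t ^+ 2)%:E < +oo)%E ->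
  X \in Lfun mu 2%:E.
Proof.
move=> mX X2; apply/andP; split; rewrite inE/=; first exact: mX.
rewrite /finite_norm unlock /Lnorm poweR_lty//.
under eq_integral => t _ do
  rewrite /= powR_mulrn// real_normK ?num_real//.
exact: X2.
Qed.

Lemma variance_le_sqr (P : probability T R) (X : T -> R) :
  X \in Lfun P 2%:E -> ('V_P[X] <= \int[P]_t (X t ^+ 2)%:E)%E.
Proof.
move=> X2; rewrite varianceE// [in leRHS](_ : \int[P]_t _ = 'E_P[X ^+ 2])%E.
  rewrite leeBlDr ?fin_numX ?expectation_fin_num ?Lfun_subset12 //;
    last exact: fin_num_measure.
  by rewrite leeDl// sqre_ge0.
by rewrite unlock.
Qed.

(** Fatou's lemma for the squares, whose lower limit is [X t ^+ 2] almost
    everywhere. *)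
Lemma fatou_sqr (mu : {measure set T -> \bar R}) (X_ : nat -> T -> R)
    (X : T -> R) (B : \bar R) :
  (forall n, measurable_fun [set: T] (X_ n)) -> measurable_fun [set: T] X ->
  {ae mu, forall t, X_ n t @[n --> \oo] --> X t} ->
  (forall n, \int[mu]_t (X_ n t ^+ 2)%:E <= B)%E ->
  (\int[mu]_t (X t ^+ 2)%:E <= B)%E.
Proof.
move=> mX_ mX XX XB; pose f n t := (X_ n t ^+ 2)%:E.
have mf n : measurable_fun [set: T] (f n).
  by apply/measurable_EFinP; exact: measurable_funX.
have f0 n t : [set: T] t -> (0 <= f n t)%E by rewrite lee_fin sqr_ge0.
apply: (@le_trans _ _ (\int[mu]_t limn_einf (f^~ t))%E).
  apply: ae_ge0_le_integral => //.
  - by move=> t _; rewrite lee_fin sqr_ge0.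
  - by apply/measurable_EFinP; exact: measurable_funX.
  - move=> t _; rewrite limn_einf_lim; apply: lime_ge; first exact: is_cvg_einfs.
    by apply: nearW => n; apply: le_ereal_inf_tmp => _ [m _ <-]; exact: f0.
  (* Measurability of upper limits is transported by passing to opposites. *)
  - rewrite (_ : (fun t => _) = -%E \o (fun t => limn_esup (-%E \o f^~ t))).
      apply: measurableT_comp => //; apply: measurable_fun_limn_esup => n.
      exact: measurableT_comp.
    by apply/funext => t; rewrite /= limn_esupN oppeK.
  - apply: filterS XX => t XXt _.
    have ft : f n t @[n --> \oo] --> (X t ^+ 2)%:E.
      by apply: cvg_EFin; [exact: nearW|exact: (cvgM XXt XXt)].
    by rewrite (cvg_limn_einf_sup ft).1.
apply: le_trans (fatou _ _ _ _) _ => //.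
rewrite limn_einf_lim; apply: lime_le; first exact: is_cvg_einfs.
apply: nearW => n; apply: le_trans (XB n).
by apply: ereal_inf_lbound; exists n => /=.
Qed.

End square_integrable.

(** * Products of independent random variables *)

Section independence.
Context {d : measure_display} {T : measurableType d} {R : realType}.

Lemma integrable_distribution (P : probability T R) (X : {RV P >-> R}) :
  (X : T -> R) \in Lfun P 1 ->
  (distribution P X).-integrable setT (EFin : R -> \bar R).
Proof.
move=> /Lfun1_integrable/integrableP[mX X1]; apply/integrableP; split => //.
by rewrite ge0_integral_distribution//; apply: measurableT_comp.
Qed.

Lemma integral_distribution_id (P : probability T R) (X : {RV P >-> R}) :
  (X : T -> R) \in Lfun P 1 -> (\int[distribution P X]_x x%:E = 'E_P[X])%E.
Proof.
move=> /Lfun1_integrable X1.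
by rewrite (integral_distribution _ X1) ?unlock//.
Qed.

(** Independence says that the joint law of [(X, Y)] agrees with the product of
    the laws on rectangles, hence everywhere; Fubini's theorem for
    [(x, y) |-> x * y] then factors the expectation. *)
Lemma expectationM_independent (P : probability T R) (X Y : {RV P >-> R}) :
  (forall A B : set R, measurable A -> measurable B ->
    P (X @^-1` A `&` Y @^-1` B) = P (X @^-1` A) * P (Y @^-1` B))%E ->
  (X : T -> R) \in Lfun P 1 -> (Y : T -> R) \in Lfun P 1 ->
  ((X : T -> R) * (Y : T -> R) \in Lfun P 1) /\
  ('E_P[(X : T -> R) * (Y : T -> R)] = 'E_P[X] * 'E_P[Y])%E.
Proof.
move=> indXY X1 Y1.
have mXY : measurable_fun [set: T] (fun t => (X t, Y t)).
  exact: measurable_fun_pair.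
pose Z : {mfun T >-> (R * R)%type} := mfun_Sub (mem_set mXY).
pose PX : probability R R := distribution P X.
pose PY : probability R R := distribution P Y.
have joint A : measurable A -> (PX \x PY)%E A = distribution P Z A.
  by apply: product_measure_unique => B C mB mC; rewrite -indXY.
have mf : @measurable_fun _ _ (R * R)%type R setT (fun z => z.1 * z.2).
  by apply: measurable_funM; [exact: measurable_fst|exact: measurable_snd].
have {}mf := iffRL (measurable_EFinP _ _) mf.
have PX1 : PX.-integrable setT EFin := integrable_distribution _ _ X1.
have PY1 : PY.-integrable setT EFin := integrable_distribution _ _ Y1.
have intf : (PX \x PY)%E.-integrable setT (EFin \o (fun z : R * R => z.1 * z.2)).
  apply/integrable12ltyP => //.
  (* By Tonelli, the integral of [`|x * y|] is the product of two finite ones. *)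
  have /integrableP[mid PX1oo] := PX1; have /integrableP[_ PY1oo] := PY1.
  under eq_integral => x _.
    under eq_integral => y _ do rewrite /= normrM EFinM.
    rewrite ge0_integralZl//; last exact: measurableT_comp.
    over.
  rewrite /= ge0_integralZr//; last 2 first.
  - exact: measurableT_comp.
  - exact: integral_ge0.
  by rewrite lte_mul_pinfty// ?integral_ge0// ge0_fin_numE ?integral_ge0.
have intfZ : P.-integrable setT (EFin \o (fun t => X t * Y t)).
  have /integrableP[_ foo] := intf; apply/integrableP; split.
    by apply/measurable_EFinP; apply: measurable_funM.
  apply: le_lt_trans foo; rewrite (eq_measure_integral (distribution P Z)).
    by rewrite ge0_integral_distribution//; exact: measurableT_comp.
  by move=> A mA _; exact: joint.
split; first exact/Lfun1_integrable.
transitivity (\int[PX \x PY]_z (z.1 * z.2)%:E)%E.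
  rewrite (eq_measure_integral (distribution P Z)).
    by rewrite integral_distribution// unlock.
  by move=> A mA _; exact: joint.
rewrite -integral12_prod_meas1// /fubini_F.
under eq_integral => x _.
  under eq_integral => y _ do rewrite /= EFinM.
  rewrite integralZl//.
  over.
rewrite integral_distribution_id//= -(fineK (expectation_fin_num Y1)).
by rewrite integralZr// integral_distribution_id.
Qed.

End independence.

(** * Tails of a convergent series of squares *)

Section square_tail.
Context {R : realType}.
Variables (c : nat -> R) (v : R).
Hypothesis cvgv : \sum_(i < n) c i ^+ 2 @[n --> \oo] --> v.

Definition tail N := v - \sum_(i < N) c i ^+ 2.

Lemma sum_sqr_tail N M : (N <= M)%N ->
  \sum_(N <= i < M) c i ^+ 2 = tail N - tail M.
Proof.
move=> NM; rewrite /tail -!(big_mkord xpredT (fun i => c i ^+ 2)).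
rewrite (big_cat_nat (m := 0) (n := N) (p := M))//=; ring.
Qed.

Lemma cvg_tail : tail N @[N --> \oo] --> 0.
Proof. by rewrite -[0](subrr v); apply: cvgB => //; exact: cvg_cst. Qed.

Lemma cvg_sum_sqr_tail N :
  \sum_(N <= i < M) c i ^+ 2 @[M --> \oo] --> tail N.
Proof.
have : tail N - tail M @[M --> \oo] --> tail N - 0.
  by apply: cvgB; [exact: cvg_cst|exact: cvg_tail].
rewrite subr0; apply: cvg_trans; apply: near_eq_cvg; near=> M.
by rewrite sum_sqr_tail//; near: M; exact: nbhs_infty_ge.
Unshelve. all: by end_near. Qed.

Lemma tail_ge0 N : 0 <= tail N.
Proof.
rewrite -(cvg_lim _ (cvg_sum_sqr_tail N))//; apply: limr_ge.
  by apply/cvg_ex; exists (tail N); exact: cvg_sum_sqr_tail.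
by apply: nearW => M; apply: sumr_ge0 => i _; exact: sqr_ge0.
Qed.

Lemma nneseries_sqr_tail N :
  (\sum_(N <= i <oo) (c i ^+ 2)%:E = (tail N)%:E)%E.
Proof.
apply/cvg_lim => //; apply: cvg_EFin.
  by apply: nearW => M; rewrite sumEFin.
apply: cvg_trans (cvg_sum_sqr_tail N); apply: near_eq_cvg; apply: nearW => M.
by rewrite /= sumEFin.
Qed.

End square_tail.

(** * Series of uncorrelated random variables *)

Definition block {T : Type} {R : realType} (s : nat -> T -> R) (c : nat -> R)
  (N M : nat) : T -> R := fun t => \sum_(N <= i < M) s i t * c i.

Section orthonormal_series.
Context {d : measure_display} {T : measurableType d} {R : realType}.
Context {P : probability T R} {s : nat -> T -> R}.
Hypothesis s2 : forall n, s n \in Lfun P 2%:E.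
Hypothesis Es : forall n, ('E_P[s n] = 0)%E.
Hypothesis covs : forall i j, covariance P (s i) (s j) = (i == j)%:R%:E.
Variable c : nat -> R.

Local Notation block := (block s c).

Lemma block_geq N M : (M <= N)%N -> block N M = cst 0.
Proof. by move=> MN; apply/funext => t; rewrite /block big_geq. Qed.

Lemma blockS N M : (N <= M)%N -> block N M.+1 = block N M \+ c M \o* s M.
Proof. by move=> NM; apply/funext => t; rewrite /block big_nat_recr. Qed.

Let fin_P : P [set: T] \is a fin_num. Proof. exact: fin_num_measure. Qed.

Lemma Lfun2_block N M : block N M \in Lfun P 2%:E.
Proof.
elim: M => [|M IHM]; first by rewrite block_geq// Lfun_cst.
have [MN|NM] := leqP M.+1 N; first by rewrite block_geq// Lfun_cst.
by rewrite blockS// rpredD ?lee1n//= Lfun_scale// ler1n.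
Qed.

Lemma expectation_block N M : ('E_P[block N M] = 0)%E.
Proof.
elim: M => [|M IHM]; first by rewrite block_geq// expectation_cst.
have [MN|NM] := leqP M.+1 N; first by rewrite block_geq// expectation_cst.
rewrite blockS// expectationD ?(Lfun_subset12 fin_P) ?Lfun2_block//; last first.
  by rewrite Lfun_scale// ler1n.
by rewrite IHM add0e expectationZl ?(Lfun_subset12 fin_P)// Es mule0.
Qed.

Lemma covariance_block N M j : (M <= j)%N ->
  covariance P (block N M) (s j) = 0%E.
Proof.
elim: M => [|M IHM] Mj; first by rewrite block_geq// covariance_cst_l.
have [MN|NM] := leqP M.+1 N; first by rewrite block_geq// covariance_cst_l.
rewrite blockS// covarianceDl ?Lfun2_block ?Lfun_scale ?ler1n//.
rewrite IHM ?(ltnW Mj)// add0e covarianceZl ?Lfun2_mul_Lfun1//; last 2 first.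
  by rewrite (Lfun_subset12 fin_P).
  by rewrite (Lfun_subset12 fin_P).
by rewrite covs (ltn_eqF Mj) mule0.
Qed.

Lemma variance_block N M :
  ('V_P[block N M] = (\sum_(N <= i < M) c i ^+ 2)%:E)%E.
Proof.
elim: M => [|M IHM]; first by rewrite block_geq// big_geq// variance_cst.
have [MN|NM] := leqP M.+1 N.
  by rewrite block_geq// big_geq// variance_cst.
have sM1 : s M \in Lfun P 1 by exact: (Lfun_subset12 fin_P).
have bM1 : block N M \in Lfun P 1.
  exact: (Lfun_subset12 fin_P) (Lfun2_block _ _).
rewrite blockS// varianceD ?Lfun2_block ?Lfun_scale ?ler1n//.
rewrite IHM varianceZ// covarianceZr// ?Lfun2_mul_Lfun1 ?Lfun2_block//.
rewrite covariance_block// !mule0 adde0 /variance covs eqxx mule1.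
by rewrite big_nat_recr//= EFinD.
Qed.

Lemma integral_sqr_block N M :
  (\int[P]_t (block N M t ^+ 2)%:E = (\sum_(N <= i < M) c i ^+ 2)%:E)%E.
Proof.
rewrite -variance_block varianceE ?Lfun2_block// expectation_block.
by rewrite expe2 mule0 sube0 unlock.
Qed.

Variables (p : T -> R) (v : R).
Hypothesis mp : measurable_fun [set: T] p.
Hypothesis cvgp : {ae P, forall t, block 0 M t @[M --> \oo] --> p t}.
Hypothesis cvgv : \sum_(i < n) c i ^+ 2 @[n --> \oo] --> v.

Local Notation tail := (tail c v).

(** This links the sections, whose variance is known exactly, with the errors,
    which involve the limit [p]. *)
Lemma block_error N M : (N <= M)%N ->
  block N M = (p \- block 0 N) \- (p \- block 0 M).
Proof.
move=> NM; apply/funext => t /=.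
rewrite /block (big_cat_nat (m := 0) (n := N) (p := M))//=; ring.
Qed.

Lemma measurable_block N M : measurable_fun [set: T] (block N M).
Proof. by apply: set_mem; apply: sub_Lfun_mfun (Lfun2_block N M). Qed.

(** The error after [N] terms is the almost sure limit of the sections starting
    at [N], whose second moments are below the tail. *)
Lemma integral_sqr_error_le N :
  (\int[P]_t ((p \- block 0 N) t ^+ 2)%:E <= (tail N)%:E)%E.
Proof.
apply: (@fatou_sqr _ _ _ _ (block N)).
- exact: measurable_block.
- by apply: measurable_funB => //; exact: measurable_block.
- apply: filterS cvgp => t cvgt.
  have : block 0 M t - block 0 N t @[M --> \oo] --> p t - block 0 N t.
    by apply: cvgB => //; exact: cvg_cst.
  apply: cvg_trans; apply: near_eq_cvg; near=> M.
  have NM : (N <= M)%N by near: M; exact: nbhs_infty_ge.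
  by rewrite (block_error _ _ NM)/=; ring.
- move=> M; rewrite integral_sqr_block lee_fin.
  have [NM|MN] := leqP N M; last by rewrite big_geq ?(tail_ge0 _ _ cvgv)// ltnW.
  by rewrite (sum_sqr_tail c v)// lerBlDr lerDl (tail_ge0 _ _ cvgv).
Unshelve. all: by end_near. Qed.

Lemma Lfun2_error N : p \- block 0 N \in Lfun P 2%:E.
Proof.
apply: sqr_integrable_Lfun2; last first.
  exact: le_lt_trans (integral_sqr_error_le N) (ltry _).
by apply: measurable_funB => //; exact: measurable_block.
Qed.

Lemma variance_error_le N : ('V_P[(p \- block 0 N)%R] <= (tail N)%:E)%E.
Proof.
exact: le_trans (variance_le_sqr _ _ (Lfun2_error N)) (integral_sqr_error_le N).
Qed.

(** With [X N] the error after [N] terms, the section from [N] to [M] is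
    [X N - X M] and has variance [tail N - tail M]. Expanding the variance of the
    difference and bounding the covariance by Cauchy-Schwarz gives a lower bound
    for the variance of [X N], in which the terms in [M] vanish as
    [M] tends to infinity because the variance of [X M] is at most [tail M]. *)
Lemma variance_error N : ('V_P[(p \- block 0 N)%R] = (tail N)%:E)%E.
Proof.
apply/eqP; rewrite eq_le variance_error_le/=.
have Vfin M := variance_fin_num (Lfun2_error M).
pose V M := fine 'V_P[(p \- block 0 M)%R]%E.
have EV M : ('V_P[(p \- block 0 M)%R] = (V M)%:E)%E by rewrite fineK.
have Vtail M : V M <= tail M by rewrite -lee_fin -EV variance_error_le.
have V0 M : 0 <= V M by rewrite -lee_fin -EV variance_ge0.
have bound M : (N <= M)%N ->
    tail N <= V N + 2 * tail M + 2 * (Num.sqrt (tail N) * Num.sqrt (tail M)).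
  move=> NM.
  have L2N := Lfun2_error N; have L2M := Lfun2_error M.
  have L1N := Lfun_subset12 fin_P L2N; have L1M := Lfun_subset12 fin_P L2M.
  have L1NM := Lfun2_mul_Lfun1 L2N L2M.
  have := variance_block N M; rewrite (block_error _ _ NM) varianceB// !EV.
  (* The covariance enters with a minus sign, hence the opposite of [X N]. *)
  have L2N' : (\- (p \- block 0 N)) \in Lfun P 2%:E by rewrite rpredN.
  have := covariance_le L2N' L2M.
  rewrite covarianceNl// varianceN// !EV.
  rewrite -(fineK (covariance_fin_num L1N L1M L1NM)).
  set k := fine _; rewrite /= lee_fin => kle.
  rewrite (sum_sqr_tail c v)// => -[VE].
  have sqle : Num.sqrt (V N) * Num.sqrt (V M) <=
      Num.sqrt (tail N) * Num.sqrt (tail M).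
    by apply: ler_pM; rewrite ?sqrtr_ge0// ler_wsqrtr.
  by have := Vtail M; lra.
have cvg_bound : V N + 2 * tail M + 2 * (Num.sqrt (tail N) * Num.sqrt (tail M))
    @[M --> \oo] --> V N.
  have cvg_sqrt : Num.sqrt (tail M) @[M --> \oo] --> 0.
    rewrite -(sqrtr0 R); apply: cvg_comp; first exact: (cvg_tail _ _ cvgv).
    exact: sqrt_continuous.
  have := cvgD (cvgD (cvg_cst (V N)) (cvgMl_tmp (a := 2) (cvg_tail _ _ cvgv)))
    (cvgMl_tmp (a := 2) (cvgMl_tmp (a := Num.sqrt (tail N)) cvg_sqrt)).
  by rewrite !mulr0 !addr0; apply.
rewrite EV lee_fin -(cvg_lim _ cvg_bound)//.
apply: limr_ge; first by apply/cvg_ex; exists (V N); exact: cvg_bound.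
by near=> M; apply: bound; near: M; exact: nbhs_infty_ge.
Unshelve. all: by end_near. Qed.

End orthonormal_series.

(** * Standardized independent variables *)

Section iid.
Context {d : measure_display} {T : measurableType d} {R : realType}.
Context {P : probability T R} {Rd : probability R R} {s : nat -> {RV P >-> R}}.
Hypothesis sRd : identically_distributed Rd s.
Hypothesis ERd : ('E_Rd[idfun] = 0)%E.
Hypothesis VRd : ('V_Rd[idfun] = 1)%E.

Lemma integral_sqr_standardized : (\int[Rd]_x (x ^+ 2)%:E = 1)%E.
Proof.
rewrite -VRd /variance covariance.unlock ERd expectation.unlock.
by apply: eq_integral => x _ /=; rewrite fctE/= subr0 expr2.
Qed.

Lemma integral_sqr_iid n : (\int[P]_t (s n t ^+ 2)%:E = 1)%E.
Proof.
rewrite -integral_sqr_standardized.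
rewrite (eq_measure_integral (distribution P (s n))); last first.
  by move=> A mA _; exact/esym/sRd.
rewrite ge0_integral_distribution//.
  by apply/measurable_EFinP; exact: measurable_funX.
by move=> y; rewrite lee_fin sqr_ge0.
Qed.

Lemma Lfun2_iid n : (s n : T -> R) \in Lfun P 2%:E.
Proof. by apply: sqr_integrable_Lfun2 => //; rewrite integral_sqr_iid ltry. Qed.

Lemma Lfun1_iid n : (s n : T -> R) \in Lfun P 1.
Proof. by apply: Lfun_subset12 (Lfun2_iid n); exact: fin_num_measure. Qed.

Lemma expectation_iid n : ('E_P[s n] = 0)%E.
Proof.
rewrite -(integral_distribution_id _ _ (Lfun1_iid n)) -ERd expectation.unlock.
by apply: eq_measure_integral => A mA _; exact: sRd.
Qed.

Lemma covariance_iid : independent_RVs s -> forall i j,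
  covariance P (s i) (s j) = (i == j)%:R%:E.
Proof.
move=> inds i j; have [<-|ij] := eqVneq i j.
  rewrite -/(variance P (s i)) varianceE ?Lfun2_iid// expectation_iid.
  by rewrite expe2 mule0 sube0 expectation.unlock -(integral_sqr_iid i).
have [l1 EM] : ((s i : T -> R) * (s j : T -> R) \in Lfun P 1) /\
    ('E_P[(s i : T -> R) * (s j : T -> R)] = 'E_P[s i] * 'E_P[s j])%E.
  apply: expectationM_independent; [|exact: Lfun1_iid|exact: Lfun1_iid].
  move=> A B mA mB.
  have := inds [fset i; j]%fset (fun k => if k == i then A else B).
  rewrite big_fsetU1 ?inE// big_seq_fset1 eqxx [j == i]eq_sym (negbTE ij) => <-.
    congr (P _); apply/seteqP; split => t /=.
      move=> [At Bt] k; rewrite /= !inE => /orP[]/eqP ->; first by rewrite eqxx.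
      by rewrite eq_sym (negbTE ij).
    move=> h; split; first by have := h i; rewrite /= !inE eqxx; apply.
    by have := h j; rewrite /= !inE eqxx orbT eq_sym (negbTE ij); apply.
  by move=> k; case: ifP.
by rewrite covarianceE ?Lfun1_iid// EM !expectation_iid mule0 sube0.
Qed.

End iid.

(** * Variance of the truncation error *)

Theorem theorem6 (R : realType) (d : nat) (Omega : set 'rV[R]_d)
    (C : Omega -> Omega -> R)
    (H : set (Omega -> R)) (ip : (Omega -> R) -> (Omega -> R) -> R)
    (w : nat -> Omega -> R)
    (Rd : probability R R)
    (disp : measure_display) (T : measurableType disp) (P : probability T R)
    (s : nat -> {RV P >-> R}) (p : Omega -> {RV P >-> R}) :
  bounded_domain Omega ->
  continuous (fun z : Omega * Omega => C z.1 z.2) ->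
  symmetric_kernel C ->
  positive_definite_kernel C ->
  is_native_space C H ip ->
  complete_orthonormal_system H ip w ->
  ('E_Rd[idfun] = 0)%E ->
  ('V_Rd[idfun] = 1)%E ->
  independent_RVs s ->
  identically_distributed Rd s ->
  is_expansion_path s w p ->
  forall N : nat, (1 <= N)%N ->
    (forall t : T, H (truncated_path s w N t)) /\
    forall x : Omega,
      [/\ measurable_fun [set: T] (path_error s w p N x),
          ('V_P[path_error s w p N x] =
            (C x x - \sum_(n < N) w n x ^+ 2)%R%:E)%E,
          ((C x x - \sum_(n < N) w n x ^+ 2)%R%:E =
            \sum_(N <= n <oo) (w n x ^+ 2)%:E)%E
        & ('V_P[path_error s w p N.+1 x] =
            'V_P[path_error s w p N x] - (w N x ^+ 2)%:E)%E].
Proof.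
move=> _ _ _ _ HC Hw ERd VRd inds sRd pE N _.
have Hip := native_ips HC; have HCx := native_kernel HC; have wH := cons_mem Hw.
split=> [t|x]; first exact: (lincomb_mem Hip (fun i => s i t)).
pose c n := w n x; pose S n : T -> R := s n.
have cvgc : \sum_(n < M) c n ^+ 2 @[M --> \oo] --> C x x.
  rewrite -(native_reproducing HC x (HCx x)).
  have := parseval Hip Hw _ (HCx x).
  apply: cvg_trans; apply: near_eq_cvg; apply: nearW => M.
  apply: eq_bigr => n _.
  by rewrite (ips_sym Hip)// (native_reproducing HC).
have errE M : path_error s w p M x = p x \- block S c 0 M.
  by apply/funext => t; rewrite /path_error /truncated_path /block /= big_mkord.
have cvgp : {ae P, forall t, block S c 0 M t @[M --> \oo] --> p x t}.
  apply: filterS (pE x) => t; apply: cvg_trans; apply: near_eq_cvg.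
  by apply: nearW => M; rewrite /block big_mkord.
have s2 : forall n, S n \in Lfun P 2%:E := Lfun2_iid sRd ERd VRd.
have Es := expectation_iid sRd ERd VRd.
have covs := covariance_iid sRd ERd VRd inds.
have mp : measurable_fun [set: T] (p x) by [].
have VE M : ('V_P[path_error s w p M x] =
    (C x x - \sum_(n < M) w n x ^+ 2)%R%:E)%E.
  by rewrite errE; exact: (variance_error s2 Es covs c (p x) (C x x)).
split => //.
- rewrite errE; apply: measurable_funB => //; exact: (measurable_block s2 c).
- exact/esym/(nneseries_sqr_tail c).
- by rewrite !VE big_ord_recr/= -EFinB opprD addrA.
Qed.
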